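(* Let $p$ be an odd prime and let $s \in \mathbb{N}=\{1,2,3,\dots\}$. For all $n_1, n_2, \ldots, n_s, k \in \mathbb{Z}_+=\{0,1,2,\dots\}$ with $n_1+n_2+\cdots+n_s > sk$, $$\int_{\mathbb{Z}_p} \left(\prod_{i=1}^{s} B_{k,n_i}(x)\right) d\mu_{-1}(x) = \begin{cases} 2+E_{n_1+n_2+\cdots+n_s} & \text{if } k=0,\\[2mm] \displaystyle\left(\prod_{i=1}^{s}\binom{n_i}{k}\right)\sum_{j=0}^{sk}\binom{sk}{j}(-1)^{sk-j}E_{n_1+n_2+\cdots+n_s-j} & \text{if } k>0.\end{cases}$$
   Context: For a uniformly differentiable function $f:\mathbb{Z}_p \to \mathbb{C}_p$ (in particular any polynomial), the fermionic $p$-adic invariant integral on $\mathbb{Z}_p$ is $$\int_{\mathbb{Z}_p} f(x)\, d\mu_{-1}(x) = \lim_{N\to\infty} \sum_{x=0}^{p^N-1} f(x)(-1)^x,$$ where the limit is taken in the $p$-adic topology. For $k,n\in\mathbb{Z}_+$ the Bernstein polynomial is $B_{k,n}(x) = \binom{n}{k} x^k (1-x)^{n-k}$ for $k \le n$, and $B_{k,n}(x)=0$ for $n<k$ (where $\binom{n}{k}=0$). The Euler numbers $E_n\in\mathbb{Q}$ ($n\ge 0$) are defined by $\frac{2}{e^t+1} = \sum_{n=0}^{\infty} E_n \frac{t^n}{n!}$ and are regarded as elements of $\mathbb{Q}_p$. *)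

(* Defs.v *)
From HB Require Import structures.
From mathcomp Require Import all_boot all_order all_algebra.
From mathcomp Require Import all_classical all_reals interval_inference topology.

Set Implicit Arguments.
Unset Strict Implicit.
Unset Printing Implicit Defensive.
Import Order.TTheory GRing.Theory Num.Theory.
Local Open Scope classical_set_scope.
Local Open Scope ring_scope.

(* The field C_p, given by its defining properties (which determine it up to
   isometric isomorphism): an algebraically closed field, complete for a
   non-archimedean absolute value with |p| = 1/p, in which the elements
   algebraic over Q_p are dense. The absolute value forces characteristic 0
   and restricts to the p-adic one on rat, so completeness makes the closure
   of rat a copy of Q_p. *)
HB.mixin Record isPadicComplex (R : realType) (p : nat) K
    of GRing.ClosedField K & CompletePseudoMetric R K := {
  padic_abs : K -> R;
  padic_abs_ge0 : forall x, 0 <= padic_abs x;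
  padic_abs_eq0 : forall x, padic_abs x = 0 <-> x = 0;
  padic_absM : forall x y, padic_abs (x * y) = padic_abs x * padic_abs y;
  padic_abs_ultra : forall x y,
    padic_abs (x + y) <= Num.max (padic_abs x) (padic_abs y);
  padic_abs_p : padic_abs p%:R = p%:R^-1;
  padic_ballE : forall (x : K) (e : R), ball x e = ball_ padic_abs x e;
  padic_algebraic_dense :
    closure [set x : K | exists q : {poly K},
      [/\ q != 0, forall i, closure (range (ratr : rat -> K)) q`_i
        & root q x]] = setT
}.

#[short(type="padicComplexType")]
HB.structure Definition PadicComplex (R : realType) (p : nat) :=
  {K of isPadicComplex R p K & GRing.ClosedField K
      & CompletePseudoMetric R K}.

Section PadicIntegral.
Context {R : realType} {p : nat} {K : padicComplexType R p}.

Definition padicQ : set K := closure (range (ratr : rat -> K)).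

Definition padicZ : set K := [set x | padicQ x /\ padic_abs x <= 1].

Lemma padic_abs_nat (n : nat) : padic_abs (n%:R : K) <= 1.
Proof.
have abs1 : padic_abs (1 : K) = 1.
  have n0 : padic_abs (1 : K) != 0.
    by apply/eqP => /padic_abs_eq0/eqP; rewrite oner_eq0.
  by apply: (mulfI n0); rewrite -padic_absM !mulr1.
elim: n => [|n IHn]; first by rewrite (padic_abs_eq0 _).2.
by rewrite -natr1 (le_trans (padic_abs_ultra _ _)) // ge_max IHn abs1 lexx.
Qed.

Lemma padicZ_natr (n : nat) : padicZ (n%:R : K).
Proof.
split; last exact: padic_abs_nat.
by apply: subset_closure; exists n%:R => //; rewrite ratr_nat.
Qed.

Definition padicZ_nat (n : nat) : padicZ :=
  exist _ (n%:R : K) (mem_set (padicZ_natr n)).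

Definition fermionic_sum (f : padicZ -> K) (N : nat) : K :=
  \sum_(0 <= x < p ^ N) f (padicZ_nat x) * (-1) ^+ x.

(* Meaningful when the sums converge, as they do for uniformly differentiable
   f; otherwise the value of lim is arbitrary. *)
Definition fermionic_integral (f : padicZ -> K) : K :=
  lim (fermionic_sum f @ \oo).

Lemma padic_hausdorff : hausdorff_space K.
Proof.
rewrite (ball_hausdorff (K : pseudoMetricType R)) => x y xy.
have d0 : 0 < padic_abs (x - y).
  rewrite lt_def padic_abs_ge0 andbT; apply: contra xy => /eqP/padic_abs_eq0.
  by move/eqP; rewrite subr_eq0.
exists (PosNum d0, PosNum d0); apply/eqP/seteqP; split=> // z [xz /ball_sym].
move: xz; rewrite !padic_ballE /ball_ /= => xz zy.
by have := padic_abs_ultra (x - z) (z - y); rewrite addrA subrK leNgt gt_max xz zy.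
Qed.

Lemma fermionic_integral_lim (f : padicZ -> K) (l : K) :
  fermionic_sum f @ \oo --> l -> fermionic_integral f = l.
Proof. by move=> fl; apply: cvg_lim => //; exact: padic_hausdorff. Qed.

End PadicIntegral.

Arguments padicZ {R p} K.

Definition bernstein {F : nzRingType} (k n : nat) : {poly F} :=
  if (k <= n)%N then 'C(n, k)%:R *: ('X^k * (1 - 'X) ^+ (n - k)) else 0.

(* A formal power series over F is the sequence of its coefficients. *)
Section FormalPowerSeries.
Variable F : fieldType.
Implicit Types a b : nat -> F.

Definition fps_const (c : F) : nat -> F := fun n => if n is 0 then c else 0.

Definition fps_add a b : nat -> F := fun n => a n + b n.

Definition fps_mul a b : nat -> F := fun n => \sum_(i < n.+1) a i * b (n - i)%N.

(* The first n coefficients of 1 / a. *)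
Fixpoint fps_inv_seq a n : seq F :=
  if n is m.+1 then
    let s := fps_inv_seq a m in
    rcons s ((a 0%N)^-1 *
             (fps_const 1 m - \sum_(i < m) a i.+1 * s`_(m - i.+1)))
  else [::].

Definition fps_inv a : nat -> F := fun n => (fps_inv_seq a n.+1)`_n.

Definition fps_div a b : nat -> F := fps_mul a (fps_inv b).

Definition fps_exp : nat -> F := fun n => (n`!%:R)^-1.

Lemma size_fps_inv_seq a n : size (fps_inv_seq a n) = n.
Proof. by elim: n => //= n IHn; rewrite size_rcons IHn. Qed.

Lemma nth_fps_inv_seq a n i : (i < n)%N -> (fps_inv_seq a n)`_i = fps_inv a i.
Proof.
elim: n => // n IHn; rewrite ltnS leq_eqVlt => /orP[/eqP -> //|lt_in].
by rewrite /= nth_rcons size_fps_inv_seq lt_in IHn.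
Qed.

Lemma fps_mulV a : a 0%N != 0 -> fps_mul a (fps_inv a) =1 fps_const 1.
Proof.
move=> a0 n; rewrite /fps_mul big_ord_recl subn0.
rewrite {1}/fps_inv /= nth_rcons size_fps_inv_seq ltnn eqxx mulVKf //.
rewrite [X in _ - X + _](_ : _ = \sum_(i < n) a i.+1 * fps_inv a (n - i.+1)).
  by rewrite subrK.
by apply: eq_bigr => i _; rewrite nth_fps_inv_seq // ltn_subrL; case: n i => [[]|].
Qed.

End FormalPowerSeries.

(* E_n, with 2 / (e^t + 1) = \sum_n E_n t^n / n! *)
Definition euler (n : nat) : rat :=
  n`!%:R *
  fps_div (fps_const 2) (fps_add (@fps_exp rat) (fps_const 1)) n.

Lemma euler_egf :
  fps_mul (fps_add (@fps_exp rat) (fps_const 1)) (fun n => euler n / n`!%:R)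
  =1 fps_const 2.
Proof.
pose a := fps_add (@fps_exp rat) (fps_const 1).
have a0 : a 0%N != 0 by [].
have eulerE n : euler n / n`!%:R = 2 * fps_inv a n.
  rewrite /euler mulrC mulKf ?pnatr_eq0 -?lt0n ?fact_gt0 //.
  rewrite /fps_div /fps_mul big_ord_recl subn0 big1 ?addr0 // => i _.
  by rewrite /= mul0r.
move=> n; transitivity (2 * fps_const 1 n : rat); last by case: n.
rewrite -(fps_mulV a0) /fps_mul mulr_sumr; apply: eq_bigr => i _.
by rewrite eulerE mulrCA.
Qed.

(* Main.v *)
Require Import Defs.
From HB Require Import structures.
From mathcomp Require Import all_boot all_order all_algebra.
From mathcomp Require Import all_classical all_reals topology.
From mathcomp Require Import normedtype sequences ring.

(** If [h(x + 1) + h(x) = 2 q(x)] for polynomials [h] and [q], the alternating sum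
of [q] over [0 <= x < p ^ N] telescopes to [(h(0) + h(p ^ N)) / 2], because
[p ^ N] is odd; as [p ^ N] tends to [0] the fermionic integral of [q] is [h(0)].
For [q = x ^ n] one takes for [h] the Euler polynomial, whose value at [0] is
[E_n]. The reflection [x |-> 1 - x] turns [x ^ (s k) (1 - x) ^ (m - s k)] into
[(1 - x) ^ (s k) x ^ (m - s k)], which the binomial theorem expands into the
monomials of the sum; if [g] solves [g(x + 1) + g(x) = 2 r(x)] for the latter,
[g(2 - x)] solves it for the former, and [g(2)] differs from [g(0)] by the values of the integrand
at [0] and [1], that is by [2] if [k = 0] and by [0] otherwise. *)

Set Implicit Arguments.
Unset Strict Implicit.
Unset Printing Implicit Defensive.
Import Order.TTheory GRing.Theory Num.Theory.
Local Open Scope classical_set_scope.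
Local Open Scope ring_scope.

(** * The rationals inside a field of characteristic zero *)

Section RatEmbedding.
Variable F : fieldType.
Hypothesis F0 : [pchar F] =i pred0.

Lemma intr_neq0_pchar0 (a : int) : a != 0 -> a%:~R != 0 :> F.
Proof.
move/pcharf0P: F0 => n0.
by case: a => a; rewrite ?NegzE ?mulrNz ?oppr_eq0 -?pmulrn n0.
Qed.

(** [ratr] uses the reduced fraction; cross-multiplying with [a / b] gives an identity of integers,
    which maps to any [F]. Since [F] carries no order, characteristic zero alone makes the
    denominators invertible, and the morphism laws follow. *)
Lemma ratr_div_pchar0 (a b : int) :
  b != 0 -> ratr (a%:~R / b%:~R) = a%:~R / b%:~R :> F.
Proof.
move=> b0; rewrite /ratr; set x : rat := a%:~R / b%:~R.
have xb : x * b%:~R = a%:~R by rewrite divfK ?intr_eq0.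
have e : numq x * b = a * denq x.
  by apply: (@intr_inj rat); rewrite !intrM numqE mulrAC xb.
apply/eqP; rewrite eqr_div ?intr_neq0_pchar0 ?denq_neq0 // -!intrM.
by rewrite e.
Qed.

Lemma ratrD_pchar0 : {morph (ratr : rat -> F) : x y / x + y}.
Proof.
move=> x y; rewrite -[x in LHS]divq_num_den -[y in LHS]divq_num_den.
have dx := denq_neq0 x; have dy := denq_neq0 y.
rewrite addf_div ?intr_eq0 // -!intrM -intrD ratr_div_pchar0 ?mulf_neq0 //.
by rewrite intrD !intrM -addf_div ?intr_neq0_pchar0.
Qed.

Lemma ratrM_pchar0 : {morph (ratr : rat -> F) : x y / x * y}.
Proof.
move=> x y; rewrite -[x in LHS]divq_num_den -[y in LHS]divq_num_den.
have dx := denq_neq0 x; have dy := denq_neq0 y.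
rewrite mulf_div -!intrM ratr_div_pchar0 ?mulf_neq0 //.
by rewrite !intrM -mulf_div.
Qed.

End RatEmbedding.

(** * Euler numbers and Euler polynomials *)

Lemma euler_rec (n : nat) :
  (\sum_(i < n.+1) 'C(n, i)%:R * euler i) + euler n = (2 * (n == 0))%N%:R.
Proof.
(* Compare the coefficients of [t ^ n] in the generating identity, times [n!]: the factor [e^t]
   yields the binomial sum, the constant [1] the lone [euler n]. *)
have := euler_egf n => /(congr1 ( *%R n`!%:R)).
have fn0 m : m`!%:R != 0 :> rat by rewrite pnatr_eq0 -lt0n fact_gt0.
rewrite /fps_mul mulr_sumr.
under eq_bigr => i _ do rewrite /fps_add mulrDl mulrDr.
rewrite big_split /= => H.
have -> : (2 * (n == 0))%N%:R = n`!%:R * fps_const 2 n :> rat.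
  by case: (n) => [|m] /=; rewrite ?mulr0 ?muln0.
rewrite -H; congr +%R.
  rewrite (reindex_inj rev_ord_inj) /=; apply: eq_bigr => i _.
  rewrite subSS /fps_exp -(bin_fact (leq_ord i)) bin_sub ?leq_ord //.
  by rewrite !natrM; field; rewrite !fn0.
rewrite big_ord_recl /= mul1r subn0 mulrC divfK // big1 ?addr0 // => i _.
by rewrite mul0r mulr0.
Qed.

Section EulerPolynomial.
Variable F : fieldType.
Hypothesis F0 : [pchar F] =i pred0.

Definition euler_poly (n : nat) : {poly F} :=
  \poly_(j < n.+1) ('C(n, j)%:R * ratr (euler (n - j))).

Lemma horner_euler_poly0 n : (euler_poly n).[0] = ratr (euler n).
Proof. by rewrite horner_coef0 coef_poly /= bin0 mul1r subn0. Qed.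

Lemma horner_euler_poly1 n :
  (euler_poly n).[1] + (euler_poly n).[0] = (2 * (n == 0))%N%:R.
Proof.
rewrite horner_euler_poly0 horner_poly -ratr_nat -euler_rec ratrD_pchar0 //.
rewrite (big_morph _ (ratrD_pchar0 F0) (ratr_nat _ 0)); congr +%R.
rewrite (reindex_inj rev_ord_inj) /=; apply: eq_bigr => i _.
rewrite subSS expr1n mulr1 bin_sub ?leq_ord // subKn ?leq_ord //.
by rewrite ratrM_pchar0 // ratr_nat.
Qed.

Lemma deriv_euler_poly n : (euler_poly n.+1)^`() = euler_poly n *+ n.+1.
Proof.
apply/polyP => i; rewrite coef_deriv coefMn !coef_poly ltnS.
case: ifP => // _; last by rewrite !mul0rn.
rewrite -!mulrnAl -!mulrnA.
by rewrite mulnC -mul_bin_diag mulnC.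
Qed.

Lemma poly_deriv_eq0 (q : {poly F}) : q^`() = 0 -> q.[0] = 0 -> q = 0.
Proof.
move=> q'0 q0; apply/polyP => -[|i]; first by rewrite -horner_coef0 q0 coef0.
have := coef_deriv q i; rewrite q'0 !coef0 => /esym/eqP.
by rewrite -mulr_natr mulf_eq0 ((pcharf0P F).1 F0) orbF => /eqP.
Qed.

(** Induction on [n]: by the Appell property [deriv_euler_poly], the derivative of the defect of
    rank [n + 1] is [n + 1] times the defect of rank [n], and every defect vanishes at [0] by the
    recurrence for the Euler numbers. *)
Lemma euler_poly_shift n :
  (euler_poly n \Po ('X + 1)) + euler_poly n = 2 *: 'X^n.
Proof.
apply/eqP; rewrite -subr_eq0; apply/eqP.
have at0 m : (euler_poly m \Po ('X + 1) + euler_poly m - 2 *: 'X^m).[0] = 0.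
  rewrite !hornerE horner_comp !hornerE horner_euler_poly1.
  by case: m => [|m]; rewrite ?expr0 ?exprS /=; ring.
elim: n => [|n IHn]; apply: poly_deriv_eq0 => //.
  have e0 : (euler_poly 0)^`() = 0.
    by apply/polyP => i; rewrite coef_deriv coef_poly mul0rn coef0.
  by rewrite !derivE deriv_comp e0 comp_poly0 mul0r scaler0 subr0 addr0.
rewrite !derivE deriv_comp !derivE addr0 mulr1 deriv_euler_poly.
by rewrite rmorphMn -scalerMnr -mulrnDl -mulrnBl IHn mul0rn.
Qed.

End EulerPolynomial.

(** * Telescoping of alternating sums *)

Lemma alternating_sum_telescope (F : comNzRingType) (q h : {poly F}) (M : nat) :
  (h \Po ('X + 1)) + h = 2 *: q -> odd M ->
  2 * (\sum_(0 <= x < M) q.[x%:R] * (-1) ^+ x) = h.[0] + h.[M%:R].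
Proof.
move=> hq oddM.
(* With the sign kept, the formula holds for every length and is proved by induction; oddness of [M]
   only fixes the final sign. *)
suff : forall m, 2 * (\sum_(0 <= x < m) q.[x%:R] * (-1) ^+ x) =
    h.[0] - (-1) ^+ m * h.[m%:R].
  by move->; rewrite -signr_odd oddM expr1 mulN1r opprK.
elim=> [|m IHm]; first by rewrite big_geq // mulr0 expr0 mul1r subrr.
rewrite big_nat_recr //= mulrDr IHm mulrA.
have := congr1 (horner^~ m%:R) hq; rewrite !hornerE horner_comp !hornerE.
by move=> <-; rewrite natr1 exprS; ring.
Qed.

(** * The p-adic absolute value and convergence of the fermionic sums *)

Section PadicAbs.
Variables (R : realType) (p : nat) (K : padicComplexType R p).
Hypothesis p_prime : prime p.
Implicit Types x : K.

Lemma padic_abs0 : padic_abs (0 : K) = 0.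
Proof. exact/padic_abs_eq0. Qed.

Lemma padic_abs_neq0 x : x != 0 -> padic_abs x != 0.
Proof. by move=> x0; apply: contra x0 => /eqP/padic_abs_eq0/eqP. Qed.

Lemma padic_abs1 : padic_abs (1 : K) = 1.
Proof.
apply: (mulfI (padic_abs_neq0 (oner_neq0 K))).
by rewrite -padic_absM !mulr1.
Qed.

Lemma padic_absX x m : padic_abs (x ^+ m) = padic_abs x ^+ m.
Proof. by elim: m => [|m IHm]; rewrite ?padic_abs1 // !exprS padic_absM IHm. Qed.

Lemma padic_absN x : padic_abs (- x) = padic_abs x.
Proof.
suff N1 : padic_abs (-1 : K) = 1 by rewrite -mulN1r padic_absM N1 mul1r.
apply/eqP; rewrite -(@pexpr_eq1 _ _ 2) ?padic_abs_ge0 //.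
by rewrite -padic_absX sqrrN expr1n padic_abs1.
Qed.

(** The prime [p] is nonzero because its absolute value is [1 / p]. For another prime [q], Bezout
    gives [u q = v p + 1]; if [q] were [0], then [v p = -1] would have absolute value [1], yet it is
    at most [1 / p]. *)
Lemma pchar_padic : [pchar K] =i pred0.
Proof.
move=> q; apply/negP => /andP[q_prime /eqP q0].
have [p0 p1] : (0 < p)%N /\ (1 < p)%N by rewrite prime_gt0 ?prime_gt1.
have [qp|q_neq_p] := eqVneq q p.
  have p_eq0 : p%:R = 0 :> K by move: q0; rewrite qp.
  have := padic_abs_p (s := K); rewrite p_eq0 padic_abs0 => /esym/eqP.
  by rewrite invr_eq0 pnatr_eq0 -leqn0 leqNgt p0.
have cop : coprime q p by rewrite prime_coprime // dvdn_prime2.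
case: (egcdnP p (prime_gt0 q_prime)) => u v.
rewrite (eqP (cop : gcdn q p == 1%N)) => /(congr1 (fun m => m%:R : K)).
rewrite natrM q0 mulr0 natrD natrM => /esym/eqP; rewrite addr_eq0 => /eqP e.
have : padic_abs (v%:R * p%:R : K) = 1 by rewrite e padic_absN padic_abs1.
rewrite padic_absM padic_abs_p => e1.
have : padic_abs (v%:R : K) * p%:R^-1 < 1.
  rewrite (le_lt_trans (ler_wpM2r _ (padic_abs_nat v))) ?invr_ge0 ?ler0n //.
  by rewrite mul1r invf_lt1 ?ltr1n ?ltr0n.
by rewrite e1 ltxx.
Qed.

(** Natural numbers lie in the closed unit ball, so by the ultrametric inequality the largest
    absolute value of a coefficient is a bound. *)
Lemma horner_nat_bounded (q : {poly K}) :
  exists c : R, forall m : nat, padic_abs q.[m%:R] <= c.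
Proof.
elim/poly_ind: q => [|q c [d qd]].
  by exists 0 => m; rewrite horner0 padic_abs0.
exists (Num.max d (padic_abs c)) => m; rewrite !hornerE.
apply: le_trans (padic_abs_ultra _ _) _.
rewrite ge_max !le_max lexx orbT andbT padic_absM (le_trans _ (qd m)) //.
by rewrite ler_piMr ?padic_abs_ge0 ?padic_abs_nat.
Qed.

Lemma fermionic_sum_cvg (q h : {poly K}) :
  odd p -> (h \Po ('X + 1)) + h = 2 *: q ->
  fermionic_sum (fun x : padicZ K => q.[val x]) @ \oo --> h.[0].
Proof.
move=> p_odd hq; apply/cvg_ballP => e e0.
(* The error is [- d(p ^ N) p ^ N / 2], and [d] is bounded on the naturals, so a geometric sequence
   of ratio [1 / p] dominates it. *)
have [d hd] : exists d : {poly K}, h = d * 'X + h.[0]%:P.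
  have /factor_theorem[d hd] : root (h - h.[0]%:P) 0 by rewrite /root !hornerE subrr.
  by exists d; rewrite -[LHS](subrK h.[0]%:P) hd subr0.
have [c dc] := horner_nat_bounded d.
have two0 : 2 != 0 :> K by rewrite ((pcharf0P K).1 pchar_padic).
pose a := padic_abs (2^-1 : K) * c.
have p1 : `|p%:R^-1 : R| < 1.
  by rewrite ger0_norm ?invr_ge0 ?ler0n // invf_lt1 ?ltr1n ?ltr0n ?prime_gt0 ?prime_gt1.
have near0 := cvgr_lt _ (cvg_geometric a p1) _ e0.
apply: filterS (near0 _) => N; rewrite /geometric /= => aN.
rewrite padic_ballE /ball_ /=; apply: le_lt_trans aN.
have := alternating_sum_telescope hq (_ : odd (p ^ N)).
rewrite oddX p_odd orbT => /(_ isT) e2.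
have hpN : h.[(p ^ N)%:R] = d.[(p ^ N)%:R] * p%:R ^+ N + h.[0].
  by rewrite {1}hd hornerD hornerMX hornerC natrX.
have -> : h.[0] - fermionic_sum (fun x : padicZ K => q.[val x]) N =
    2^-1 * (- (d.[(p ^ N)%:R]) * p%:R ^+ N).
  apply: (mulfI two0); rewrite mulrBr [X in _ - X]e2 hpN mulVKf //.
  by ring.
rewrite !padic_absM padic_absX padic_abs_p padic_absN.
by rewrite mulrA ler_wpM2r ?ler_wpM2l ?exprn_ge0 ?invr_ge0 ?padic_abs_ge0 ?dc.
Qed.

End PadicAbs.

(** * Products of Bernstein polynomials and the reflection *)

Lemma bernstein_prod (F : comNzRingType) (s k : nat) (n : 'I_s -> nat) :
  (forall i, k <= n i)%N ->
  \prod_(i < s) (bernstein k (n i) : {poly F}) =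
  (\prod_(i < s) 'C(n i, k)%:R) *:
    ('X^(s * k) * (1 - 'X) ^+ (\sum_(i < s) n i - s * k)).
Proof.
move=> kn; rewrite (eq_bigr (fun i => 'C(n i, k)%:R *:
  ('X^k * (1 - 'X) ^+ (n i - k)))) => [|i _]; last by rewrite /bernstein kn.
rewrite scaler_prod big_split /= prodr_const card_ord -exprM mulnC.
rewrite prodrXr; congr (_ *: (_ * _ ^+ _)).
(* The truncated differences add up correctly because each [k <= n i]. *)
by rewrite sumnB // sum_nat_const card_ord.
Qed.

Lemma bernstein_prod0 (F : comNzRingType) (s k : nat) (n : 'I_s -> nat) i :
  (n i < k)%N -> \prod_(i < s) (bernstein k (n i) : {poly F}) = 0.
Proof.
move=> nk; by rewrite (bigD1 i) //= {1}/bernstein leqNgt nk mul0r.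
Qed.

Lemma exp1BX_expansion (F : comNzRingType) (a m : nat) : (a <= m)%N ->
  (1 - 'X) ^+ a * 'X^(m - a) =
  \sum_(j < a.+1) ('C(a, j)%:R * (-1) ^+ (a - j)) *: 'X^(m - j) :> {poly F}.
Proof.
move=> am; rewrite addrC exprDn mulr_suml; apply: eq_bigr => j _.
have ja : (j <= a)%N by rewrite -ltnS.
rewrite expr1n mulr1 [(- 'X) ^+ _]exprNn -mul_polyC polyCM polyC_exp.
rewrite polyCN polyC_natr polyC1.
have -> : (m - j = (a - j) + (m - a))%N by rewrite addnC addnBA // subnK.
by rewrite exprD; ring.
Qed.

(** Put [y = 1 - x]: then [2 - (x + 1) = y] and [2 - x = y + 1], so the two terms on the left merely
    swap. *)
Lemma shift_equation_reflect (F : comNzRingType) (g r : {poly F}) :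
  (g \Po ('X + 1)) + g = 2 *: r ->
  ((g \Po (2 - 'X)) \Po ('X + 1)) + (g \Po (2 - 'X)) = 2 *: (r \Po (1 - 'X)).
Proof.
move=> gr; rewrite -comp_polyZ -gr [RHS]comp_polyD -!comp_polyA addrC.
congr ((g \Po _) + (g \Po _)).
  by rewrite comp_polyD comp_polyX comp_polyC; ring.
by rewrite comp_polyB comp_polyX -polyC_natr comp_polyC polyC_natr; ring.
Qed.

Theorem theorem10 (R : realType) (p : nat) (K : padicComplexType R p)
    (s : nat) (n : 'I_s -> nat) (k : nat) :
  prime p -> odd p -> (0 < s)%N ->
  (s * k < \sum_(i < s) n i)%N ->
  let f := fun x : padicZ K => \prod_(i < s) (bernstein k (n i)).[val x] in
  let m := (\sum_(i < s) n i)%N in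
  cvg (fermionic_sum f @ \oo) /\
  fermionic_integral f =
    if k == 0%N then 2 + ratr (euler m)
    else (\prod_(i < s) 'C(n i, k)%:R) *
         \sum_(0 <= j < (s * k).+1)
            'C(s * k, j)%:R * (-1) ^+ (s * k - j) * ratr (euler (m - j)).
Proof.
move=> p_prime p_odd s_gt0 km f m.
have K0 := pchar_padic K p_prime.
pose q : {poly K} := \prod_(i < s) bernstein k (n i).
have -> : f = fun x => q.[val x] by apply/funext => x; rewrite /f horner_prod.
suff [h hq <-] : exists2 h, (h \Po ('X + 1)) + h = 2 *: q & h.[0] =
    if k == 0%N then 2 + ratr (euler m)
    else (\prod_(i < s) 'C(n i, k)%:R) *
         \sum_(0 <= j < (s * k).+1)
            'C(s * k, j)%:R * (-1) ^+ (s * k - j) * ratr (euler (m - j)).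
  have hl := fermionic_sum_cvg p_prime p_odd hq.
  by split; [exact: cvgP hl|exact: fermionic_integral_lim].
(* If some [n i < k], then [k > 0] and both sides vanish, the right one through ['C(n i, k) = 0];
   hence [h = 0]. *)
have [/forallP kn|/forallPn[i]] := boolP [forall i, (k <= n i)%N]; last first.
  rewrite -ltnNge => nk; exists 0.
    by rewrite /q (bernstein_prod0 _ nk) comp_poly0 addr0 scaler0.
  rewrite (bigD1 i) //= bin_small // !mul0r horner0.
  by case: (k) nk.
(* Each monomial in the expansion of [r] is replaced by the Euler polynomial of the same degree, so
   [g] solves the shift equation for [r] by linearity. *)
pose g : {poly K} := \sum_(j < (s * k).+1)
  ('C(s * k, j)%:R * (-1) ^+ (s * k - j)) *: euler_poly K (m - j).
pose r : {poly K} := (1 - 'X) ^+ (s * k) * 'X^(m - s * k).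
have gr : (g \Po ('X + 1)) + g = 2 *: r.
  rewrite /r exp1BX_expansion 1?ltnW // scaler_sumr /g raddf_sum -big_split.
  apply: eq_bigr => j _ /=.
  by rewrite comp_polyZ -scalerDr euler_poly_shift // !scalerA mulrC.
pose C : K := \prod_(i < s) 'C(n i, k)%:R.
exists (C *: (g \Po (2 - 'X))).
  rewrite comp_polyZ -scalerDr (shift_equation_reflect gr) /q bernstein_prod //.
  rewrite scalerA mulrC -scalerA; congr (_ *: (_ *: _)).
  rewrite /r rmorphM !rmorphXn /= comp_polyB comp_polyC comp_polyX.
  by congr (_ ^+ _ * _); ring.
have gE x : g.[x + 1] = 2 * r.[x] - g.[x].
  have := congr1 (horner^~ x) gr.
  by rewrite hornerD horner_comp hornerZ !hornerE => <-; rewrite addrK.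
(* The shift equation at [1] and then at [0] brings [g(2)] back to [g(0)]. *)
have -> : (C *: (g \Po (2 - 'X))).[0] = C * (2 * r.[1] - 2 * r.[0] + g.[0]).
  rewrite hornerZ horner_comp (_ : (2 - 'X).[0] = 1 + 1); last by rewrite !hornerE subr0.
  by rewrite gE -[in g.[1]](add0r 1) gE; ring.
(* The strict inequality [s k < m] leaves a positive power of ['X] in [r]. *)
have -> : r.[0] = 0.
  by rewrite /r !hornerE expr0n subn_eq0 leqNgt km mulr0.
(* This is [0 ^ (s k)], and [s k = 0] exactly when [k = 0] since [s > 0]. *)
have -> : r.[1] = (k == 0%N)%:R.
  by rewrite /r !hornerE subrr expr0n muln_eq0 -[s == _]negbK -lt0n s_gt0 expr1n mulr1.
have g0 : g.[0] = \sum_(0 <= j < (s * k).+1)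
            'C(s * k, j)%:R * (-1) ^+ (s * k - j) * ratr (euler (m - j)).
  rewrite big_mkord horner_sum; apply: eq_bigr => j _.
  by rewrite hornerZ horner_euler_poly0.
rewrite g0 mulr0 subr0.
case: ifP => k0; last by rewrite mulr0 add0r.
(* For [k = 0] only the term [j = 0] remains and [C = 1]. *)
rewrite /C (eqP k0) muln0 big_nat1 bin0 expr0 subn0 !mul1r mulr1.
by rewrite big1 ?mul1r // => i _; rewrite bin0.
Qed.
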